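(* There exists an absolute constant $C>0$ such that the following holds. Let $X$ be a finite set, let $0<p<1$, let $n$ and $s$ be positive integers, let $r>0$, let $\Lambda\subseteq\mathbb R_{\ge0}^X$, and let $\Lambda_0$ be a finite subset of $\Lambda$. Suppose that for every $\lambda\in\Lambda_0$ there is given a set $C_\lambda\subseteq X$ with $|C_\lambda|\le n$, and that $|\Lambda_0|\ge p^{-n}$. If, for all distinct $\lambda,\lambda'\in\Lambda_0$, \[ \lambda(C_\lambda\setminus C_{\lambda'})\ge r, \] then, with probability at least $1-2^{-s-1}$, \[ Z_\Lambda(X_{Csp})\ge(1-2^{-s})\,r . \]
   Context: For $\lambda\in\mathbb R_{\ge0}^X$ and $W\subseteq X$, $\lambda(W)=\sum_{x\in W}\lambda(x)$. For $A\subseteq X$, $Z_\Lambda(A)=\sup_{\lambda\in\Lambda}\lambda(A)$ (possibly $+\infty$). For $q\in[0,1]$, $X_q$ denotes the random subset of $X$ containing each element independently with probability $q$; if $q\ge1$, $X_q$ is interpreted as the full set $X$. *)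

(* Defs.v *)
From HB Require Import structures.
From mathcomp Require Import all_boot all_order all_algebra finmap.
From mathcomp Require Import all_classical all_reals all_analysis.

Set Implicit Arguments.
Unset Strict Implicit.
Unset Printing Implicit Defensive.

Import Order.TTheory GRing.Theory Num.Theory.

Local Open Scope classical_set_scope.
Local Open Scope ring_scope.

Definition weight (R : realType) (X : finType) (lam : {ffun X -> R})
  (W : {set X}) : R := \sum_(x in W) lam x.

Definition Zsup (R : realType) (X : finType) (Lam : set {ffun X -> R})
  (A : {set X}) : \bar R :=
  ereal_sup [set (weight lam A)%:E | lam in Lam].

(* The probability that X_q equals A, for q >= 0. Truncating q at 1 makes X_q
   almost surely the full set when q >= 1. *)
Definition rsubset_pmf (R : realType) (X : finType) (q : R) (A : {set X}) : R :=
  \prod_(x : X) (if x \in A then Num.min q 1 else 1 - Num.min q 1).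

Definition rsubset_prob (R : realType) (X : finType) (q : R)
  (E : pred {set X}) : R :=
  \sum_(A : {set X} | E A) rsubset_pmf q A.

(* Main.v *)
(* Call W light if lambda(W) < r for all lambda in Lambda_0. If W is light, then
   its union with some C_lambda determines lambda: were C_lambda' contained in
   that union for some lambda' <> lambda, W would contain
   C_lambda' \ C_lambda and so have lambda'-weight at least r. Adding a set of
   size at most n costs a factor q^-n in the distribution of X_q, so
   q^n |Lambda_0| P(X_q is light) <= 1, and P(X_4p is light) <= 4^-n <= 1/4.
   Lightness passes to subsets and X_4sp dominates the union of s independent
   copies of X_4p, so X_4sp is light with probability at most 4^-s <= 2^-(s+1).
   When 4sp >= 1, the full set is not light because |Lambda_0| > 1. *)
Require Import Defs.
From HB Require Import structures.
From mathcomp Require Import all_boot all_order all_algebra finmap.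
From mathcomp Require Import all_classical all_reals all_analysis.
From mathcomp Require Import ring lra.

Set Implicit Arguments.
Unset Strict Implicit.
Unset Printing Implicit Defensive.

Import Order.TTheory GRing.Theory Num.Theory.

Local Open Scope classical_set_scope.
Local Open Scope ring_scope.

(* Allowing the probability a x to depend on x makes a deterministic set C an
   instance, with a the indicator of C. *)
Definition subset_pmf (R : realType) (X : finType) (a : X -> R) (A : {set X}) : R :=
  \prod_(x : X) (if x \in A then a x else 1 - a x).

Lemma subset_pmf_ge0 (R : realType) (X : finType) (a : X -> R) (A : {set X}) :
  (forall x, 0 <= a x <= 1) -> 0 <= subset_pmf a A.
Proof.
move=> a01; apply: prodr_ge0 => x _.
by have /andP[a0 a1] := a01 x; case: ifP => _; rewrite ?subr_ge0.
Qed.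

Lemma sum_subset_pmf (R : realType) (X : finType) (a : X -> R) :
  \sum_(A : {set X}) subset_pmf a A = 1.
Proof.
rewrite /subset_pmf -(@bigA_distr _ _ _ _ _ _ a (fun x => 1 - a x)).
by apply: big1 => x _ /=; rewrite subrKC.
Qed.

Lemma subset_pmf_indic (R : realType) (X : finType) (C : {set X}) :
  subset_pmf (fun x => (x \in C)%:R : R) C = 1.
Proof. by apply: big1 => x _; case: (x \in C); rewrite ?subr0. Qed.

(** Independence across points reduces this to a single point, which lies in A or B with probability
    1 - (1 - a)(1 - b). Expanding the product over x then produces the sums over A and B. *)
Lemma subset_pmfU (R : realType) (X : finType) (a b : X -> R) (Z : {set X}) :
  subset_pmf (fun x => a x + b x - a x * b x) Z =
  \sum_(A : {set X}) \sum_(B : {set X} | A :|: B == Z)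
    subset_pmf a A * subset_pmf b B.
Proof.
(* [F] is the contribution of x in B, [G] that of x outside B. Each vanishes unless A ∪ B and Z
   agree at x, so expanding the product over B enforces A ∪ B = Z. *)
pose F (A : {set X}) x := (if x \in A then a x else 1 - a x) * (b x * (x \in Z)%:R).
pose G (A : {set X}) x := (if x \in A then a x else 1 - a x) *
  ((1 - b x) * ((x \in A) == (x \in Z))%:R).
transitivity (\sum_(A : {set X}) \prod_x (F A x + G A x)); last first.
  apply: eq_bigr => A _; rewrite (@bigA_distr _ _ _ _ _ _ (F A) (G A)).
  rewrite [RHS]big_mkcond; apply: eq_bigr => B _; case: eqP => [ABZ|neqZ].
    rewrite /subset_pmf -big_split; apply: eq_bigr => x _ /=.
    by rewrite /F /G -ABZ inE; case: (x \in A); case: (x \in B) => /=; rewrite ?mulr1.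
  have [x Zx] : exists x, (x \in A :|: B) != (x \in Z).
    apply/existsP; apply: contra_notT neqZ => /existsPn ABZ.
    by apply/setP => x; apply/eqP; rewrite -[_ == _]negbK ABZ.
  rewrite (bigD1 x) //=; move: Zx; rewrite inE /F /G.
  by case: (x \in A); case: (x \in B); case: (x \in Z); rewrite //= ?mulr0 ?mul0r.
(* The same split for A: a point of A must lie in Z whatever B is, while outside A membership in B
   decides. *)
pose F1 x := a x * (x \in Z)%:R.
pose G1 x := (1 - a x) * (b x * (x \in Z)%:R + (1 - b x) * (x \notin Z)%:R).
transitivity (\prod_x (F1 x + G1 x)).
  apply: eq_bigr => x _; rewrite /F1 /G1; case: (x \in Z) => /=; ring.
rewrite (@bigA_distr _ _ _ _ _ _ F1 G1); apply: eq_bigr => A _; apply: eq_bigr => x _.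
rewrite /F /G /F1 /G1; case: (x \in A); case: (x \in Z) => /=; ring.
Qed.

(** The laws of X_q ∪ C and X_q have the same factors off C. On C the former has factor 1 or 0, and
    multiplying it by q brings it below q or 1 - q. *)
Lemma sum_subset_pmf_setU_le (R : realType) (X : finType) (q : R) (C : {set X})
    (E : pred {set X}) :
  0 <= q <= 1 ->
  q ^+ #|C| * (\sum_(W : {set X} | E W) subset_pmf (fun=> q) W) <=
  \sum_(Z : {set X} | [exists W : {set X}, E W && (W :|: C == Z)])
    subset_pmf (fun=> q) Z.
Proof.
move=> q01; have /andP[q0 q1] := q01.
have indic01 x : 0 <= ((x \in C)%:R : R) <= 1 by case: (x \in C); rewrite ?lexx ler01.
rewrite (partition_big (fun W => W :|: C)
  (fun Z => [exists W : {set X}, E W && (W :|: C == Z)])) /=; last first.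
  by move=> W EW; apply/existsP; exists W; rewrite EW eqxx.
rewrite mulr_sumr; apply: ler_sum => Z _.
apply: (@le_trans _ _ (q ^+ #|C| *
    subset_pmf (fun x => q + (x \in C)%:R - q * (x \in C)%:R) Z)).
  apply: ler_wpM2l; first exact: exprn_ge0.
  (* C is viewed as a random set with 0-1 marginals; in the sum over B only the term B = C, of mass
     1, is kept. *)
  rewrite subset_pmfU big_mkcond; apply: ler_sum => A _.
  have sum_ge0 (P : pred {set X}) : 0 <= \sum_(B : {set X} | P B)
      subset_pmf (fun=> q) A * subset_pmf (fun x => (x \in C)%:R) B.
    by apply: sumr_ge0 => B _; apply: mulr_ge0; apply: subset_pmf_ge0.
  case: ifP => [/andP[_ ACZ]|_]; last exact: sum_ge0.
  rewrite (bigD1 C) //= subset_pmf_indic mulr1 lerDl; exact: sum_ge0.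
rewrite -prodr_const big_mkcond -big_split; apply: ler_prod => x _ /=.
by case: (x \in C); case: (x \in Z) => /=; apply/andP; split; nra.
Qed.

(** If A ∪ B satisfies [D], then so do A and B, and for independent A and B these two events are
    independent. *)
Lemma sum_subset_pmf_decreasingU (R : realType) (X : finType) (a b : R)
    (D : pred {set X}) :
  0 <= a <= 1 -> 0 <= b <= 1 ->
  (forall A B : {set X}, A \subset B -> D B -> D A) ->
  \sum_(Z | D Z) subset_pmf (fun=> a + b - a * b) Z <=
  (\sum_(A | D A) subset_pmf (fun=> a) A) * \sum_(B | D B) subset_pmf (fun=> b) B.
Proof.
move=> a01 b01 Ddecr.
under eq_bigr => Z _ do rewrite subset_pmfU.
rewrite exchange_big /= mulr_suml [leRHS]big_mkcond; apply: ler_sum => A _.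
rewrite (exchange_big_dep xpredT) //= mulr_sumr.
have pmf_ge0 (B : {set X}) : 0 <= subset_pmf (fun=> a) A * subset_pmf (fun=> b) B.
  by apply: mulr_ge0; apply: subset_pmf_ge0.
apply: (@le_trans _ _ (\sum_(B : {set X} | D (A :|: B))
    subset_pmf (fun=> a) A * subset_pmf (fun=> b) B)).
  rewrite [leRHS]big_mkcond; apply: ler_sum => B _; case: ifP => DAB.
    rewrite (bigD1 (A :|: B)%SET) ?DAB ?eqxx //= big1 ?addr0 // => Z.
    by rewrite -andbA => /and3P[_ /eqP->]; rewrite eqxx.
  by rewrite big1 // => Z /andP[DZ /eqP ABZ]; rewrite ABZ DZ in DAB.
case: ifP => DA; last first.
  by rewrite big1 // => B DAB; rewrite (Ddecr _ _ (finset.subsetUl A B) DAB) in DA.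
rewrite big_mkcond [leRHS]big_mkcond; apply: ler_sum => B _.
case: ifP => DAB; last by case: ifP.
by rewrite (Ddecr _ _ (finset.subsetUr A B) DAB).
Qed.

(** Monotone coupling: X_c is the union of X_a and an independent X_b, where 1 - c = (1 - a)(1 -
    b). *)
Lemma sum_subset_pmf_decreasing_le (R : realType) (X : finType) (a c : R)
    (D : pred {set X}) :
  0 <= a -> a <= c -> c <= 1 ->
  (forall A B : {set X}, A \subset B -> D B -> D A) ->
  \sum_(Z | D Z) subset_pmf (fun=> c) Z <= \sum_(A | D A) subset_pmf (fun=> a) A.
Proof.
(* The case a = 1, where b would have denominator 0, forces c = a. *)
move=> a0 ac c1 Ddecr; have [a1|a1] := leP 1 a.
  by rewrite (_ : c = a) //; apply/eqP; rewrite eq_le ac (le_trans c1 a1).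
have a'0 : 0 < 1 - a by rewrite subr_gt0.
pose b := (c - a) / (1 - a).
have b01 : 0 <= b <= 1.
  by rewrite divr_ge0 ?subr_ge0 ?(ltW a1) //= ler_pdivrMr // mul1r lerD2r.
have -> : c = a + b - a * b by rewrite /b; field; rewrite gt_eqF.
have a01 : 0 <= a <= 1 by rewrite a0 ltW.
apply: le_trans (sum_subset_pmf_decreasingU a01 b01 Ddecr) _.
rewrite ler_piMr //; first by apply: sumr_ge0 => A _; apply: subset_pmf_ge0.
rewrite -(sum_subset_pmf (fun _ : X => b)) [leLHS]big_mkcond; apply: ler_sum => B _.
by case: ifP => // _; apply: subset_pmf_ge0.
Qed.

Lemma sum_subset_pmf_decreasing_exp (R : realType) (X : finType) (a : R) (s : nat)
    (D : pred {set X}) :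
  0 <= a -> s%:R * a <= 1 ->
  (forall A B : {set X}, A \subset B -> D B -> D A) ->
  \sum_(Z | D Z) subset_pmf (fun=> s%:R * a) Z <=
  (\sum_(A | D A) subset_pmf (fun=> a) A) ^+ s.
Proof.
move=> a0 + Ddecr; elim: s => [_|s IHs sa1].
  rewrite mul0r expr0 -(sum_subset_pmf (fun _ : X => 0 : R)) [leLHS]big_mkcond.
  apply: ler_sum => B _; case: ifP => // _; apply: subset_pmf_ge0 => _.
  by rewrite lexx ler01.
have sa0 : 0 <= s%:R * a by rewrite mulr_ge0.
have saS : s.+1%:R * a = s%:R * a + a by rewrite mulrSr mulrDl mul1r.
have sa01 : 0 <= s%:R * a <= 1 by rewrite sa0; lra.
have a01 : 0 <= a <= 1 by rewrite a0; lra.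
have /andP[_ sa1'] := sa01; have /andP[_ a1] := a01.
(* The union of independent copies of X_sa and X_a has density sa + a - sa * a, at most (s + 1)a, so
   it can replace the denser set. *)
apply: (@le_trans _ _
    (\sum_(Z | D Z) subset_pmf (fun _ : X => s%:R * a + a - s%:R * a * a) Z)).
  by apply: sum_subset_pmf_decreasing_le => //; nra.
apply: le_trans (sum_subset_pmf_decreasingU sa01 a01 Ddecr) _.
rewrite exprSr ler_wpM2r ?IHs //.
by apply: sumr_ge0 => A _; apply: subset_pmf_ge0.
Qed.

Lemma weight_subset (R : realType) (X : finType) (lam : {ffun X -> R})
    (A B : {set X}) :
  (forall x, 0 <= lam x) -> A \subset B -> weight lam A <= weight lam B.
Proof.
move=> lam0 AB; rewrite /weight [leRHS](big_setID A) /= (finset.setIidPr AB) lerDl.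
exact: sumr_ge0.
Qed.

(** The events [P i], that X_q is a light set joined with C_i, are pairwise disjoint, so their
    probabilities sum to at most 1. *)
Lemma sum_subset_pmf_light_le (R : realType) (X I : finType)
    (L : I -> {ffun X -> R}) (C : I -> {set X}) (q r : R) (n : nat) :
  0 <= q <= 1 -> (forall i x, 0 <= L i x) -> (forall i, (#|C i| <= n)%N) ->
  (forall i j, i != j -> r <= weight (L i) (C i :\: C j)) ->
  q ^+ n * #|I|%:R *
    (\sum_(W : {set X} | [forall i, weight (L i) W < r]) subset_pmf (fun=> q) W)
  <= 1.
Proof.
move=> q01 L0 Cn Lr; have /andP[q0 q1] := q01.
pose E (W : {set X}) := [forall i, weight (L i) W < r].
pose P i (Z : {set X}) := [exists W : {set X}, E W && (W :|: C i == Z)].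
have Pinj i j Z : P i Z -> P j Z -> i = j.
  move=> /existsP[W /andP[/forallP EW /eqP WZ]] /existsP[V /andP[_ /eqP VZ]].
  apply/eqP; apply: contraT; rewrite eq_sym => /Lr; rewrite leNgt => /negP[].
  apply: le_lt_trans (EW j); apply: weight_subset => //.
  (* C_j lies in Z = W ∪ C_i, hence C_j minus C_i lies in W. *)
  by rewrite finset.subDset finset.setUC WZ -VZ finset.subsetUr.
have pmf0 (Z : {set X}) : 0 <= subset_pmf (fun _ : X => q) Z by apply: subset_pmf_ge0.
rewrite -[leRHS](sum_subset_pmf (fun _ : X => q)).
apply: (@le_trans _ _ (\sum_i \sum_(Z | P i Z) subset_pmf (fun=> q) Z)).
  rewrite mulrAC mulr_natr -sumr_const; apply: ler_sum => i _.
  apply: le_trans (sum_subset_pmf_setU_le (C i) E q01).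
  rewrite ler_wpM2r ?sumr_ge0 // ler_wiXn2l //; exact: Cn.
rewrite (exchange_big_dep xpredT) //=; apply: ler_sum => Z _.
case: (pickP (fun i => P i Z)) => [i Pi|P0]; last by rewrite big_pred0.
rewrite (big_pred1 i) // => j; by apply/idP/eqP => [Pj|->//]; exact: Pinj Pj Pi.
Qed.

Theorem theorem1p10 (R : realType) :
  exists C : R, 0 < C /\
    forall (X : finType) (p : R) (n s : nat) (r : R)
      (Lam : set {ffun X -> R}) (Lam0 : {fset {ffun X -> R}})
      (Cset : {ffun X -> R} -> {set X}),
    0 < p -> p < 1 -> (0 < n)%N -> (0 < s)%N -> 0 < r ->
    (forall lam, Lam lam -> forall x, 0 <= lam x) ->
    (forall lam, lam \in Lam0 -> Lam lam) ->
    (forall lam, lam \in Lam0 -> (#|Cset lam| <= n)%N) ->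
    p ^- n <= (#|` Lam0|)%:R ->
    (forall lam lam', lam \in Lam0 -> lam' \in Lam0 -> lam != lam' ->
      r <= weight lam (Cset lam :\: Cset lam')) ->
    1 - 2 ^- s.+1 <=
      rsubset_prob (C * s%:R * p)
        (fun A : {set X} => (((1 - 2 ^- s) * r)%:E <= Zsup Lam A)%E).
Proof.
exists 4; split => // X p n s r Lam Lam0 Cset p0 p1 n0 s0 r0 Lam_ge0 sLam Cn.
move=> card_ge sep; pose q : R := 4 * s%:R * p.
pose bad (W : {set X}) := [forall l : Lam0, weight (val l) W < r].
pose P (a : R) := \sum_(W | bad W) subset_pmf (fun _ : X => a) W.
have L0 (l : Lam0) x : 0 <= val l x by apply: Lam_ge0; apply/sLam/valP.
have bad_decr (A B : {set X}) : A \subset B -> bad B -> bad A.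
  move=> AB /forallP badB; apply/forallP => l.
  exact: le_lt_trans (weight_subset (L0 l) AB) (badB l).
have P_ge0 a : 0 <= a <= 1 -> 0 <= P a.
  by move=> a01; apply: sumr_ge0 => W _; apply: subset_pmf_ge0.
have round a : 0 <= a <= 1 -> a ^+ n * #|{: Lam0}|%:R * P a <= 1.
  move=> a01; apply: (@sum_subset_pmf_light_le _ _ _ (fun l : Lam0 => val l)
    (fun l => Cset (val l))) => // [l|l l' ll']; first exact/Cn/valP.
  by apply: sep; rewrite ?(inj_eq val_inj) //; apply: valP.
have {card_ge} card_ge : p ^- n <= #|{: Lam0}|%:R by rewrite -cardfE.
(* A set that is not light has weight at least r, hence at least (1 - 2^-s) r, for some member of
   [Lam0]. *)
suff Pq : P (Num.min q 1) <= 2 ^- s.+1.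
  rewrite lerBlDl; apply: le_trans (lerD Pq (lexx _)).
  have q01 (_ : X) : 0 <= Num.min q 1 <= 1.
    by rewrite le_min ge_min ler01 lexx orbT !mulr_ge0 // ltW.
  rewrite -[leLHS](sum_subset_pmf (fun _ : X => Num.min q 1)) (bigID bad) /= lerD2l.
  rewrite big_mkcond [leRHS]big_mkcond; apply: ler_sum => W _ /=.
  case: ifPn => [/forallPn[l]|_]; last by case: ifP => // _; apply: subset_pmf_ge0.
  rewrite -leNgt => rW; rewrite ifT //.
  apply: (@le_trans _ _ (weight (val l) W)%:E).
    rewrite lee_fin; apply: le_trans rW; rewrite ler_piMl ?(ltW r0) //.
  by apply: ereal_sup_ubound; exists (val l) => //; apply/sLam/valP.
have p_n : 1 < p ^- n.
  by rewrite -exprVn exprn_egt1 ?invf_gt1 // -lt0n.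
have [q1|/ltW q1] := leP 1 q.
  have one01 : 0 <= (1 : R) <= 1 by rewrite ler01 lexx.
  (* X_1 is deterministic, which enters as P 1 <= P 1 ^ 2. *)
  have := sum_subset_pmf_decreasingU one01 one01 bad_decr.
  rewrite mulr1 addrK -/(P 1) => PP.
  have := round _ one01; rewrite expr1n mul1r => NP.
  have P1 := P_ge0 _ one01.
  (* If [P 1] were positive, [PP] would give [P 1] >= 1, and then |[Lam0]| > 1 contradicts [NP]. *)
  apply: (@le_trans _ _ 0); last by rewrite invr_ge0 exprn_ge0.
  by nra.
have qE : q = s%:R * (4 * p) by rewrite /q; ring.
have a0 : 0 <= 4 * p by rewrite mulr_ge0 // ltW.
have a01 : 0 <= 4 * p <= 1.
  rewrite a0 /=; apply: le_trans q1; rewrite qE ler_peMl // ler1n //.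
rewrite qE in q1 *; apply: le_trans (sum_subset_pmf_decreasing_exp a0 q1 bad_decr) _.
rewrite -/(P (4 * p)).
have P4 : P (4 * p) <= 4^-1.
  have pn0 : 0 < p ^+ n by rewrite exprn_gt0.
  have := round _ a01; have := P_ge0 _ a01; set y := P _ => y0.
  move: card_ge; set N := #|_|%:R => card_ge.
  have : 1 <= p ^+ n * N by rewrite -ler_pdivrMl // mulr1.
  have : 4 <= 4 ^+ n :> R by rewrite -[leLHS]expr1 ler_weXn2l // ler1n.
  (* Now u v y <= 1 with u >= 4 and v >= 1, so 4 y <= 1. *)
  rewrite exprMn; set u := 4 ^+ n; set v := p ^+ n * N => u4 v1.
  rewrite -(mulrA u) -/v -mulrA => uvy.
  have y_vy : y <= v * y by rewrite ler_peMl.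
  have : 4 * (v * y) <= u * (v * y) by rewrite ler_wpM2r // (le_trans y0).
  lra.
apply: (@le_trans _ _ (4^-1 ^+ s)); first by rewrite ler_pXn2r ?nnegrE ?P_ge0.
rewrite exprVn lef_pV2 ?posrE ?exprn_gt0 //.
rewrite (_ : 4 = 2 ^+ 2 :> R); last by rewrite expr2; ring.
(* The exponents satisfy s + 1 <= 2 s because s >= 1. *)
by rewrite -exprM ler_eXn2l ?ltr1n // mul2n -addnn -addn1 leq_add2l.
Qed.
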